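(* Let $(V_1,F_1)$ and $(V_2,F_2)$ be two non-Euclidean Minkowski spaces of the same dimension $n\ge2$. If $f:U_1\to U_2$ is a conformal map between two domains $U_1\subset V_1$ and $U_2\subset V_2$, then $(V_1,F_1)$ and $(V_2,F_2)$ are isometric and $f$ is the restriction of a similarity, that is, of the composition of an isometry and a homothety $x\mapsto \mathrm{const}\cdot x$.
   Context: A Minkowski space $(V,F)$ is a finite-dimensional real vector space $V$ with a Minkowski norm $F:V\to[0,\infty)$: $F(\lambda\xi)=\lambda F(\xi)$ for $\lambda\ge0$, $F(\xi+\eta)\le F(\xi)+F(\eta)$, and $F(\xi)=0\Rightarrow\xi=0$ (no symmetry, smoothness or strong convexity is assumed). It is Euclidean if $F(\xi)=\sqrt{g(\xi,\xi)}$ for some scalar product $g$ on $V$, and non-Euclidean otherwise. It is regarded as a Finsler manifold via $F(x,\xi)=F(\xi)$ for $(x,\xi)\in TV=V\times V$. A domain is a nonempty connected open set. A conformal map $f:U_1\to U_2$ is a (smooth) diffeomorphism for which there is a function $\lambda:U_1\to(0,\infty)$ with $F_2(df_x(\xi))=\lambda(x)F_1(\xi)$ for all $x\in U_1$, $\xi\in V_1$; it is an isometry if $\lambda\equiv1$. *)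

(* Defs.v *)
From HB Require Import structures.
From mathcomp Require Import all_boot all_order all_algebra.
From mathcomp Require Import all_classical all_reals all_analysis.

Set Implicit Arguments.
Unset Strict Implicit.
Unset Printing Implicit Defensive.

Import Order.TTheory GRing.Theory Num.Theory.
Import numFieldNormedType.Exports.

Local Open Scope classical_set_scope.
Local Open Scope ring_scope.

(* Finite-dimensional normed spaces. The norm `| | only serves to put on the
   vector space its topology and differential calculus: in finite dimension
   these do not depend on which norm is chosen, and they are unrelated to the
   Minkowski norms F below. *)
#[short(type="finNormedModType")]
HB.structure Definition FinNormedModule (R : numFieldType) :=
  {V of NormedModule R V & Vector R V}.

Section Minkowski.
Variables (R : realType) (V : finNormedModType R).

Definition minkowski_norm (F : V -> R) : Prop :=
  [/\ forall xi, 0 <= F xi,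
      forall (l : R) xi, 0 <= l -> F (l *: xi) = l * F xi,
      forall xi eta, F (xi + eta) <= F xi + F eta
    & forall xi, F xi = 0 -> xi = 0].

Definition euclidean (F : V -> R) : Prop :=
  exists g : {dot V for idfun}, forall xi, F xi = Num.sqrt (g xi xi).

Definition domain (U : set V) : Prop := [/\ U !=set0, connected U & open U].

End Minkowski.

Section Smooth.
Variables (R : realType) (V1 V2 : finNormedModType R).

(* For U open. As V1 is finite-dimensional, x |-> 'd f x is of class C^k as a
   map into Hom(V1, V2) iff all its evaluations x |-> 'd f x v are. *)
Fixpoint class_C (k : nat) (U : set V1) (f : V1 -> V2) : Prop :=
  match k with
  | 0 => forall x, U x -> {for x, continuous f}
  | k'.+1 => (forall x, U x -> differentiable f x) /\
             (forall v, class_C k' U (fun x => 'd f x v))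
  end.

Definition smooth (U : set V1) (f : V1 -> V2) : Prop :=
  forall k, class_C k U f.

End Smooth.

(* A map U1 -> U2 is represented by a total function V1 -> V2 whose values
   outside of U1 are irrelevant. *)
Section Maps.
Variables (R : realType) (V1 V2 : finNormedModType R).
Variables (F1 : V1 -> R) (F2 : V2 -> R).

Definition diffeomorphism (U1 : set V1) (U2 : set V2) (f : V1 -> V2) : Prop :=
  [/\ set_bij U1 U2 f, smooth U1 f
    & exists2 g : V2 -> V1, {in U1, cancel f g} & smooth U2 g].

Definition conformal_factor (U1 : set V1) (f : V1 -> V2)
    (lambda : V1 -> R) : Prop :=
  forall x, U1 x -> forall xi, F2 ('d f x xi) = lambda x * F1 xi.

Definition conformal_map (U1 : set V1) (U2 : set V2) (f : V1 -> V2) : Prop :=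
  diffeomorphism U1 U2 f /\
  exists2 lambda : V1 -> R,
    forall x, U1 x -> 0 < lambda x & conformal_factor U1 f lambda.

Definition finsler_isometry (U1 : set V1) (U2 : set V2) (f : V1 -> V2) : Prop :=
  diffeomorphism U1 U2 f /\ conformal_factor U1 f (fun=> 1).

Definition isometric : Prop :=
  exists phi : V1 -> V2, finsler_isometry setT setT phi.

Definition similarity (h : V1 -> V2) : Prop :=
  exists c : R, exists phi : V1 -> V2,
    [/\ 0 < c, finsler_isometry setT setT phi & forall x, h x = c *: phi x].

End Maps.

(* Main.v *)
From HB Require Import structures.
Require Import Defs.
From mathcomp Require Import all_boot all_order all_algebra.
From mathcomp Require Import all_classical all_reals all_analysis.
From mathcomp Require Import ring lra.

(** Let [f] be a conformal map and [x] a point of its domain.  The maps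
    [T y := ('d f x)^-1 \o 'd f y] multiply [F1] by the factor
    [lambda y / lambda x].  The linear isometries of [F1] form a bounded group,
    so they preserve an inner product [g] ([invariant_dot], from
    [bounded_group_preserves_form]); hence the maps [T y] multiply [g] by the
    square of the same factor, and in particular this factor is differentiable.

    Differentiating at [x] in direction [u] yields an endomorphism [B u] whose
    [g]-symmetric part is the scalar [al u], where [al] is the derivative of the
    factor.  As [B u v] is a second derivative, it is symmetric in [u] and [v]
    ([second_derivative_symmetric]), and the Koszul computation
    ([conformal_prolongation]) gives
    [B u v = al u *: v + al v *: u - g u v *: a], with [a] the [g]-gradient of
    [al].  Now [B u - al u] is tangent to the level sets of [F1], and it is the
    generator [w |-> g a w *: u - g u w *: a] of the rotations in the plane of
    [a] and [u].  So if [a != 0], then [F1] is constant along every great circle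
    through [a] ([flow_preserves_levels]); these circles cover a [g]-sphere, and
    [F1] is Euclidean ([rotations_euclidean]).  For a non-Euclidean [F1] we get
    [a = 0], then [B = 0]: the second differential of [f] vanishes
    ([second_diff_conformal]).

    On a connected open set [f] is then affine ([zero_diff_constant] applied
    to the differential and to [f] minus its linear part), and its linear part
    divided by [lambda x] is an isometry.  Dimension at least two enters through
    the great circles: it puts [- a] on one of those that pass through [a].
    Since [F1] need not be differentiable, its level sets are handled through
    curves inside them and its Lipschitz continuity. *)

Set Implicit Arguments.
Unset Strict Implicit.
Unset Printing Implicit Defensive.

Import Order.TTheory GRing.Theory Num.Theory.
Import numFieldNormedType.Exports.
Import VectorInternalTheory.

Local Open Scope classical_set_scope.
Local Open Scope ring_scope.

(** * Matrix norms and coordinates *)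

Lemma lipschitz_norm_continuous (R : realType) (V W : normedModType R)
    (f : V -> W) (k : R) :
  0 < k -> (forall x y, `|f x - f y| <= k * `|x - y|) -> continuous f.
Proof.
move=> k0 fk x; apply/(@cvgrPdist_lt _ _ _ (nbhs x)) => e e0; near=> y.
rewrite (le_lt_trans (fk _ _))// mulrC -ltr_pdivlMr//; near: y.
by apply: cvgr_dist_lt => //; rewrite divr_gt0.
Unshelve. all: by end_near. Qed.

Section MatrixNorm.
Variable R : realType.

Lemma entry_le_mx_norm m n (A : 'M[R]_(m, n)) i j : `|A i j| <= `|A|.
Proof.
by rewrite [leRHS]/Num.norm /= mx_normrE; apply: (le_bigmax _ _ (i, j)).
Qed.

Lemma mx_norm_le m n (A : 'M[R]_(m, n)) c :
  0 <= c -> (forall i j, `|A i j| <= c) -> `|A| <= c.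
Proof.
by move=> c0 Ac; rewrite [leLHS]/Num.norm /= mx_normrE; apply/bigmax_leP; split.
Qed.

Lemma mx_norm_attained m n (A : 'M[R]_(m, n)) :
  A = 0 \/ exists i j, `|A| = `|A i j|.
Proof.
have [A0|/mx_norm_neq0[[i j] Aij]] := eqVneq (mx_norm A) 0.
  by left; exact: mx_norm_eq0.
by right; exists i, j.
Qed.

Lemma mx_norm_mul m n p (A : 'M[R]_(m, n)) (B : 'M[R]_(n, p)) :
  `|A *m B| <= n%:R * `|A| * `|B|.
Proof.
apply: mx_norm_le => [|i j]; first by rewrite !mulr_ge0.
rewrite mxE (le_trans (ler_norm_sum _ _ _))//.
have -> : n%:R * `|A| * `|B| = \sum_(k < n) `|A| * `|B|.
  by rewrite sumr_const card_ord -mulrA mulr_natl.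
by apply: ler_sum => k _; rewrite normrM ler_pM// entry_le_mx_norm.
Qed.

Lemma mx_norm_tr m n (A : 'M[R]_(m, n)) : `|A^T| <= `|A|.
Proof. by apply: mx_norm_le => // i j; rewrite mxE entry_le_mx_norm. Qed.

End MatrixNorm.

Section Coordinates.
Variables (R : realType) (V : finNormedModType R).

Lemma minkowski0 (F : V -> R) : minkowski_norm F -> F 0 = 0.
Proof. by case=> _ FZ _ _; rewrite -(scale0r 0) FZ ?mul0r. Qed.

Lemma minkowski_sum (F : V -> R) (I : finType) (u : I -> V) :
  minkowski_norm F -> F (\sum_i u i) <= \sum_i F (u i).
Proof.
move=> mF; have [_ _ FD _] := mF.
apply: (big_ind2 (fun x y => F x <= y)) => //; first by rewrite minkowski0.
by move=> x a y b xa yb; rewrite (le_trans (FD _ _))// lerD.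
Qed.

Lemma minkowski_le_coord (F : V -> R) : minkowski_norm F ->
  exists2 K, 0 < K & forall v, F v <= K * `|v2r v|.
Proof.
move=> mF; have [F0 FZ FD _] := mF.
pose e i : V := r2v (delta_mx 0 i).
pose K := 1 + \sum_i (F (e i) + F (- e i)).
have S0 : 0 <= \sum_i (F (e i) + F (- e i)).
  by apply: sumr_ge0 => i _; rewrite addr_ge0.
exists K => [|v]; first by rewrite ltr_wpDr.
have {1}-> : v = \sum_i (v2r v) 0 i *: e i.
  apply: v2r_inj; rewrite linear_sum [LHS]row_sum_delta.
  by apply: eq_bigr => i _; rewrite linearZ/= r2vK.
rewrite (le_trans (minkowski_sum _ mF))//.
rewrite mulrDl mul1r ler_wpDl// mulr_suml ler_sum// => i _.
set a := v2r v 0 i.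
have aM : `|a| <= `|v2r v| by exact: entry_le_mx_norm.
apply: (@le_trans _ _ (`|a| * (F (e i) + F (- e i)))); last first.
  by rewrite mulrC ler_wpM2l// addr_ge0.
have [a0|a0] := lerP 0 a.
  by rewrite FZ// (ger0_norm a0) ler_wpM2l// lerDl.
rewrite -[a *: _]opprK -scaleNr -scalerN FZ ?oppr_ge0 ?(ltW a0)//.
by rewrite (ltr0_norm a0) ler_wpM2l ?oppr_ge0 ?(ltW a0)// lerDr.
Qed.

(** The unit sphere of the coordinate space is compact and [F] does not vanish
    on it. *)
Lemma coord_le_minkowski (F : V -> R) : minkowski_norm F ->
  exists2 D, 0 < D & forall v, `|v2r v| <= D * F v.
Proof.
move=> mF; have [F0 FZ FD F_eq0] := mF.
have [K K0 FK] := minkowski_le_coord mF.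
pose f (x : 'rV[R]_(dim V)) := F (r2v x).
have flip x y : f x - f y <= K * `|x - y|.
  have := FK (r2v (x - y)); rewrite r2vK; apply: le_trans.
  by rewrite lerBlDr (le_trans _ (FD _ _))// /f -linearD subrK.
have fc : continuous f.
  apply: (@lipschitz_norm_continuous _ _ _ _ K) => // x y.
  rewrite ler_norml flip andbT lerNl opprB distrC; exact: flip.
pose S : set 'rV[R]_(dim V) := [set x | `|x| = 1].
have compactS : compact S.
  apply: bounded_closed_compact.
    by exists 1; split=> // M M1 x /= ->; exact: ltW.
  apply: (@preimage_closed _ _ (fun x : 'rV[R]_(dim V) => `|x|) [set 1]).
    by move=> x _; exact: norm_continuous.
  exact: closed_eq.
have [S0|/set0P/negP/negPn/eqP S0] := pselect (S !=set0); last first.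
  exists 1 => // v; rewrite mul1r.
  have [->|v0] := eqVneq (v2r v) 0; first by rewrite normr0.
  have : S (`|v2r v|^-1 *: v2r v).
    by rewrite /S/= normrZ normfV normr_id mulVf// normr_eq0.
  by rewrite S0.
have [c cS cmin] := EVT_min_rV S0 compactS (continuous_subspaceT fc).
have fc0 : 0 < f c.
  rewrite lt_neqAle F0 andbT eq_sym; apply/eqP => /F_eq0 /(congr1 v2r).
  rewrite r2vK linear0 => c0; move: cS; rewrite c0 inE /S/= normr0.
  by move/esym/eqP; rewrite oner_eq0.
exists (f c)^-1 => [|v]; first by rewrite invr_gt0.
rewrite mulrC ler_pdivlMr// mulrC.
have [->|v0] := eqVneq (v2r v) 0; first by rewrite normr0 mulr0.
have v0' : 0 < `|v2r v| by rewrite normr_gt0.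
have /cmin : `|v2r v|^-1 *: v2r v \in S.
  by rewrite inE /S/= normrZ normfV normr_id mulVf// normr_eq0.
by rewrite {2}/f linearZ/= v2rK FZ ?invr_ge0// mulrC ler_pdivlMr.
Qed.

(** The ambient norm is itself a Minkowski norm, so the two comparison lemmas
    above also say that coordinates and ambient norm are equivalent. *)
Lemma minkowski_normr : minkowski_norm (fun v : V => `|v|).
Proof.
split=> [xi|l xi l0|xi eta|xi]; [by []|by rewrite normrZ ger0_norm|
  exact: ler_normD|exact: normr0_eq0].
Qed.

Lemma minkowski_le_norm (F : V -> R) : minkowski_norm F ->
  exists2 K, 0 < K & forall v, F v <= K * `|v|.
Proof.
move=> /minkowski_le_coord[K K0 FK].
have [D D0 nD] := coord_le_minkowski minkowski_normr.
exists (K * D) => [|v]; first exact: mulr_gt0.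
by rewrite (le_trans (FK v))// -mulrA ler_pM2l.
Qed.

Lemma linear_fin_continuous (W : normedModType R) (f : {linear V -> W}) :
  continuous f.
Proof.
have [D D0 nD] := coord_le_minkowski minkowski_normr.
apply/linear_bounded_continuous/linear_boundedP.
pose e i : V := r2v (delta_mx 0 i).
exists (\sum_i D * `|f (e i)|); split; first exact: num_real.
move=> r Sr v.
have {1}-> : v = \sum_i (v2r v) 0 i *: e i.
  apply: v2r_inj; rewrite linear_sum [LHS]row_sum_delta.
  by apply: eq_bigr => i _; rewrite linearZ/= r2vK.
rewrite linear_sum (le_trans (ler_norm_sum _ _ _))//.
apply: le_trans (_ : (\sum_i D * `|f (e i)|) * `|v| <= _); last first.
  by rewrite ler_wpM2r// ltW.
rewrite mulr_suml ler_sum// => i _.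
rewrite linearZ/= normrZ mulrAC ler_wpM2r//.
by rewrite (le_trans (entry_le_mx_norm _ _ _)).
Qed.

End Coordinates.

(** * Bounded groups of matrices preserve an inner product *)

Section BoundedGroup.
Variables (R : realType) (n : nat).
Implicit Types (A B M N X q : 'M[R]_n).

Let frob X : R := \sum_i \sum_j X i j ^+ 2.

Let frob_ge0 X : 0 <= frob X.
Proof. by apply: sumr_ge0 => i _; apply: sumr_ge0 => j _; exact: sqr_ge0. Qed.

Let norm_le_frob X : `|X| ^+ 2 <= frob X.
Proof.
have [->|[i [j ->]]] := mx_norm_attained X; first by rewrite normr0 expr0n.
rewrite real_normK ?num_real// /frob (bigD1 i)//= (bigD1 j)//= -addrA lerDl.
rewrite addr_ge0//; first by apply: sumr_ge0 => k _; exact: sqr_ge0.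
by apply: sumr_ge0 => k _; apply: sumr_ge0 => l _; exact: sqr_ge0.
Qed.

Let frob_parallelogram A B :
  frob (2^-1 *: (A + B)) + frob (2^-1 *: (A - B)) = (frob A + frob B) / 2.
Proof.
rewrite /frob -!big_split mulr_suml; apply: eq_bigr => i _ /=.
rewrite -!big_split mulr_suml; apply: eq_bigr => j _ /=.
by rewrite !mxE; field.
Qed.

Let frob_bound X : frob X <= (n * n)%:R * `|X| ^+ 2.
Proof.
have -> : (n * n)%:R * `|X| ^+ 2 = \sum_(i < n) \sum_(j < n) `|X| ^+ 2.
  by rewrite !sumr_const !card_ord -mulrnA mulr_natl.
apply: ler_sum => i _; apply: ler_sum => j _.
rewrite -[X i j ^+ 2]real_normK ?num_real//.
by rewrite lerXn2r ?nnegrE// entry_le_mx_norm.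
Qed.

Let mulmx_continuous p (A : 'M[R]_(p, n)) (B : 'M[R]_(n, p)) :
  continuous (fun X : 'M[R]_n => A *m X *m B).
Proof.
apply: (@lipschitz_norm_continuous _ _ _ _ (n%:R * n%:R * `|A| * `|B| + 1)).
  by rewrite ltr_wpDl// !mulr_ge0.
move=> X Y; rewrite -mulmxBl -mulmxBr.
apply: (le_trans (mx_norm_mul _ _)).
rewrite mulrDl mul1r ler_wpDr//.
rewrite (_ : n%:R * n%:R * _ * _ * _ = n%:R * (n%:R * `|A| * `|X - Y|) * `|B|).
  by rewrite ler_wpM2r// ler_wpM2l// mx_norm_mul.
by ring.
Qed.

(* Matrices are encoded as row vectors, for which bounded closed sets are
   compact. *)
Let vec_mx_continuous : continuous (fun r : 'rV[R]_(n * n) => vec_mx r).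
Proof.
apply: (@lipschitz_norm_continuous _ _ _ _ 1) => // x y.
rewrite mul1r -linearB; apply: mx_norm_le => // i j.
by rewrite mxE entry_le_mx_norm.
Qed.

Let mxE_continuous k l (f : 'rV[R]_(n * n) -> 'M[R]_(k, l)) i j :
  continuous f -> continuous (fun r => f r i j).
Proof.
move=> fc r; apply: (@continuous_comp _ _ _ f (fun X : 'M[R]_(k, l) => X i j)).
  exact: fc.
exact: coord_continuous.
Qed.

Let frob_continuous (f : 'rV[R]_(n * n) -> 'M[R]_n) :
  continuous f -> continuous (fun r => frob (f r)).
Proof.
move=> fc r; apply: continuous_big => [|i _]; first exact: add_continuous.
move=> {}r; apply: continuous_big => [|j _]; first exact: add_continuous.
move=> {}r.
apply: (@continuous_comp _ _ _ (fun r => f r i j) (fun x => x ^+ 2)).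
  exact: mxE_continuous.
exact: exprn_continuous.
Qed.

(** The group acts on symmetric matrices by [M *m q *m M^T].  The supremum of
    the Frobenius norm along an orbit is an invariant function; because that
    norm is uniformly convex and orbits are uniformly non-degenerate, the
    function has exactly one minimiser on an invariant closed convex set of
    positive definite matrices, and uniqueness makes it a fixed point. *)
Lemma bounded_group_preserves_form (G : set 'M[R]_n) (D : R) :
  G 1%:M -> (forall M N, G M -> G N -> G (M *m N)) ->
  (forall M, G M -> exists2 N, G N & N *m M = 1%:M) ->
  (forall M, G M -> `|M| <= D) ->
  exists q, [/\ q^T = q,
    forall x : 'rV_n, x != 0 -> 0 < (x *m q *m x^T) 0 0
    & forall M, G M -> M *m q *m M^T = q].
Proof.
move=> G1 GM GV GD.
have D0 : 0 <= D by rewrite (le_trans _ (GD _ G1)).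
(* [c] bounds the effect of multiplying by an element of [G] on either side;
   the [+ 1] makes it positive also when [n = 0]. *)
pose c := n%:R * D + 1.
have c0 : 0 < c by rewrite ltr_wpDl// mulr_ge0.
have c_ge0 : 0 <= c by exact: ltW.
have nM M : G M -> n%:R * `|M| <= c.
  by move=> GMM; rewrite /c ler_wpDr// ler_wpM2l// GD.
have boundl p (X : 'M[R]_(p, n)) M : G M -> `|X *m M| <= c * `|X|.
  move=> GMM; rewrite (le_trans (mx_norm_mul _ _))//.
  by rewrite mulrAC ler_wpM2r// nM.
have boundr p M (X : 'M[R]_(n, p)) : G M -> `|M *m X| <= c * `|X|.
  move=> GMM; rewrite (le_trans (mx_norm_mul _ _))//.
  by rewrite ler_wpM2r// nM.
have bounde p (X : 'M[R]_(p, n)) M : G M -> `|X| <= c * `|X *m M|.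
  move=> /GV[N GN NM]; rewrite -{1}[X]mulmx1 -(mulmx1C NM) mulmxA.
  exact: boundl.
pose act M q := M *m q *m M^T.
have act1 q : act 1%:M q = q by rewrite /act trmx1 mulmx1 mul1mx.
have actM M N q : act M (act N q) = act (M *m N) q.
  by rewrite /act trmx_mul !mulmxA.
have act_le M q : G M -> `|act M q| <= c ^+ 2 * `|q|.
  move=> GMM; rewrite /act -mulmxA (le_trans (boundr _ _ _ GMM))//.
  rewrite expr2 -mulrA ler_pM2l//.
  rewrite -[q *m _]trmxK (le_trans (mx_norm_tr _))// trmx_mul trmxK.
  by rewrite (le_trans (boundr _ _ _ GMM))// ler_pM2l// mx_norm_tr.
have act_ge M q : G M -> `|q| <= c ^+ 2 * `|act M q|.
  move=> GMM; have [N GN NM] := GV _ GMM.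
  by rewrite -{1}(act1 q) -NM -actM act_le.
have actZD M a p q : act M (a *: (p + q)) = a *: (act M p + act M q).
  by rewrite /act -scalemxAr -scalemxAl mulmxDr mulmxDl.
have actB M p q : act M (p - q) = act M p - act M q.
  by rewrite /act mulmxBr mulmxBl.
(* Quantifying over [M] makes the lower bound [G]-invariant by construction. *)
pose K q := q^T = q /\ forall M (x : 'rV[R]_n), G M ->
  `|x| ^+ 2 <= c ^+ 2 * (x *m act M q *m x^T) 0 0.
have Kact M q : G M -> K q -> K (act M q).
  move=> GMM [qT qK]; split; first by rewrite /act !trmx_mul trmxK qT mulmxA.
  by move=> N x GN; rewrite actM; apply: qK; exact: GM.
have Kmid p q : K p -> K q -> K (2^-1 *: (p + q)).
  move=> [pT pK] [qT qK]; split; first by rewrite linearZ/= linearD/= pT qT.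
  move=> M x GMM; rewrite actZD -scalemxAr -scalemxAl mulmxDr mulmxDl mxE mxE.
  by have := pK M x GMM; have := qK M x GMM; lra.
have dotE (y : 'rV[R]_n) : (y *m y^T) 0 0 = \sum_j y 0 j ^+ 2.
  by rewrite mxE; apply: eq_bigr => j _; rewrite mxE.
have K1 : K 1%:M.
  split=> [|M x GMM]; first exact: trmx1.
  rewrite /act mulmx1 mulmxA -mulmxA -trmx_mul.
  apply: (@le_trans _ _ (c ^+ 2 * `|x *m M| ^+ 2)).
    by rewrite -exprMn lerXn2r ?nnegrE ?mulr_ge0 ?bounde// ltW.
  rewrite ler_pM2l ?exprn_gt0//.
  have [->|[i [j ->]]] := mx_norm_attained (x *m M).
    by rewrite normr0 expr0n mul0mx mxE.
  rewrite real_normK ?num_real// ord1 dotE (bigD1 j)//= lerDl.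
  by apply: sumr_ge0 => k _; exact: sqr_ge0.
pose E := [set r : R | exists2 q, K q & forall M, G M -> frob (act M q) <= r].
have E0 : lbound E 0 by move=> r [q _ /(_ _ G1)]; exact: le_trans.
have infE : has_inf E.
  split; last by exists 0.
  exists ((n * n)%:R * (c ^+ 2 * `|1%:M : 'M[R]_n|) ^+ 2), 1%:M => // M GMM.
  rewrite (le_trans (frob_bound _))// ler_wpM2l//.
  by rewrite lerXn2r ?nnegrE ?mulr_ge0// act_le.
set m := inf E.
have m0 : 0 <= m by apply: lb_le_inf => //; case: infE.
have /choice[u uP] : forall k, exists q,
    K q /\ forall M, G M -> frob (act M q) <= m + k.+1%:R^-1.
  move=> k; have k0 : (0 : R) < k.+1%:R^-1 by rewrite invr_gt0.
  have [r [q Kq qr] rm] := inf_adherent k0 infE.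
  by exists q; split=> // M GMM; rewrite (le_trans (qr _ GMM))// ltW.
pose C := [set r : 'rV[R]_(n * n) | `|r| <= m + 2].
have Cc : compact C.
  apply: bounded_closed_compact.
    exists (m + 2); split; first exact: num_real.
    by move=> M mM x /= /le_trans; apply; exact: ltW.
  apply: (@preimage_closed _ _ (fun x : 'rV[R]_(n * n) => `|x|)
    [set x | x <= m + 2]); last exact: closed_le.
  by move=> x _; exact: norm_continuous.
have uC k : C (mxvec (u k)).
  rewrite /C/=.
  have uk : `|u k| <= m + 2.
    have H : `|u k| ^+ 2 <= m + 1.
      have := (uP k).2 _ G1; rewrite act1 => /(le_trans (norm_le_frob _)).
      by move=> /le_trans; apply; rewrite lerD2l invf_le1// ler1n.
    rewrite leNgt; apply/negP => mu.
    have : (m + 2) ^+ 2 <= m + 1.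
      by apply: le_trans H; rewrite lerXn2r ?nnegrE ?addr_ge0// ltW.
    apply/negP; rewrite -ltNge sqrrD.
    have := sqr_ge0 m; move: m0; clearbody m; lra.
  apply: le_trans uk; apply: mx_norm_le => // i j.
  rewrite ord1; case/mxvec_indexP: j => i' j'.
  by rewrite mxvecE entry_le_mx_norm.
(* A cluster point of a minimising sequence is a minimiser: all conditions
   defining [K] and the sublevel sets are closed. *)
have [p [_ clp]] : C `&` cluster ((mxvec \o u) @ \oo) !=set0.
  by apply: Cc; exists 0%N => // k _; exact: uC.
have atom (h : 'rV[R]_(n * n) -> R) (S : set R) : closed S -> continuous h ->
    (\forall k \near \oo, S (h (mxvec (u k)))) -> S (h p).
  move=> cS hc hS; suff: closure (h @^-1` S) p.
    rewrite -(@closure_id _ (h @^-1` S)).1//.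
    by apply: preimage_closed => // x _; exact: hc.
  by move: clp; rewrite clusterE; apply.
pose q := vec_mx p.
have act_cont M : continuous (fun r : 'rV[R]_(n * n) => act M (vec_mx r)).
  move=> r; apply: (@continuous_comp _ _ _ (fun r : 'rV[R]_(n * n) => vec_mx r)
    (fun X => act M X)); first exact: vec_mx_continuous.
  exact: mulmx_continuous.
have qT : q^T = q.
  apply/matrixP => i j; rewrite mxE; apply/eqP; rewrite -subr_eq0 -normr_le0.
  apply: (atom (fun r => `|vec_mx r j i - vec_mx r i j|) [set y | y <= 0]).
    exact: closed_le.
    move=> r; apply: (@continuous_comp _ _ _
      (fun r => vec_mx r j i - vec_mx r i j) (fun x : R => `|x|)).
      by apply: continuousB; apply: mxE_continuous; exact: vec_mx_continuous.
    exact: norm_continuous.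
  exists 0%N => // k _ /=.
  by rewrite mxvecK -{1}(uP k).1.1 mxE subrr normr0.
have Kq : K q.
  split=> // M x GMM; rewrite -ler_pdivrMl ?exprn_gt0//.
  apply: (atom (fun r => (x *m act M (vec_mx r) *m x^T) 0 0)
    [set y | (c ^+ 2)^-1 * `|x| ^+ 2 <= y]); first exact: closed_ge.
    apply: (@mxE_continuous _ _ (fun r => x *m act M (vec_mx r) *m x^T)).
    move=> r; apply: (@continuous_comp _ _ _
      (fun r => act M (vec_mx r)) (fun X => x *m X *m x^T)).
      exact: act_cont.
    exact: mulmx_continuous.
  exists 0%N => // k _ /=; rewrite mxvecK ler_pdivrMl ?exprn_gt0//.
  exact: (uP k).1.2.
have qm M : G M -> frob (act M q) <= m.
  move=> GMM; apply/ler_addgt0Pr => e e0.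
  apply: (atom (fun r => frob (act M (vec_mx r))) [set y | y <= m + e]).
    exact: closed_le.
    exact: frob_continuous.
  near=> k; rewrite /= mxvecK (le_trans ((uP k).2 _ GMM))// lerD2l ltW//.
  by near: k; exact: near_infty_natSinv_lt (PosNum e0).
exists q; split=> // [x x0|M GMM].
  have := Kq.2 _ x G1; rewrite act1 => H.
  have : 0 < c ^+ 2 * (x *m q *m x^T) 0 0.
    by apply: lt_le_trans H; rewrite exprn_gt0// normr_gt0.
  by rewrite pmulr_rgt0// exprn_gt0.
(* If [act M q] differs from [q], the midpoint of these two minimisers does
   better than [m] by at least [`|d| ^+ 2 / c ^+ 4]. *)
apply/eqP/negPn/negP => Mq.
pose d := 2^-1 *: (q - act M q).
have d0 : 0 < `|d| ^+ 2.
  rewrite exprn_gt0// normr_gt0 scaler_eq0 subr_eq0 negb_or invr_eq0 pnatr_eq0.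
  by rewrite [q == _]eq_sym Mq.
suff : E (m - `|d| ^+ 2 / c ^+ 4).
  move/(ge_inf (ex_intro _ 0 E0)); rewrite -/m.
  by rewrite lerBrDr gerDl leNgt divr_gt0// exprn_gt0.
exists (2^-1 *: (q + act M q)); first exact: Kmid (Kact _ _ GMM Kq).
move=> N GN; rewrite actZD lerBrDr.
apply: (@le_trans _ _ (frob (2^-1 *: (act N q + act N (act M q)))
  + frob (2^-1 *: (act N q - act N (act M q))))).
  rewrite lerD2l -actB.
  have -> : 2^-1 *: act N (q - act M q) = act N d.
    by rewrite /d /act -scalemxAr -scalemxAl.
  apply: le_trans (norm_le_frob _); rewrite ler_pdivrMr ?exprn_gt0//.
  rewrite (_ : 4 = 2 * 2)%N// exprM -exprMn mulrC.
  by rewrite lerXn2r ?nnegrE ?mulr_ge0 ?sqr_ge0// act_ge.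
rewrite frob_parallelogram actM ler_pdivrMr//.
by rewrite mulr_natr mulr2n lerD ?qm//; exact: GM.
Unshelve. all: by end_near. Qed.

End BoundedGroup.

(** * Inner products *)

Section InnerProduct.
Variables (R : realType) (V : lmodType R).

Lemma dot_of_form (g : V -> V -> R) :
  (forall a u v w, g (a *: u + v) w = a * g u w + g v w) ->
  (forall u v, g u v = g v u) -> (forall u, u != 0 -> 0 < g u u) ->
  exists G : {dot V for idfun}, forall u v, G u v = g u v.
Proof.
move=> gl gC g_gt0.
have gr a u v w : g w (a *: u + v) = a * g w u + g w v by rewrite !(gC w) gl.
have gB u v w : g (u - v) w = g u w - g v w.
  by rewrite addrC -scaleN1r gl mulN1r addrC.
have g0 w : g 0 w = 0 by rewrite -(subrr 0) gB subrr.
have gZ a u w : g (a *: u) w = a * g u w by rewrite -[a *: u]addr0 gl g0 addr0.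
pose bil := isBilinear.Build R V V R ( *%R ) (idfun \; *%R) g
  (fun w u v => gB u v w)
  (fun w u v => etrans (gC _ _) (etrans (gB u v w)
    (congr2 (fun x y => x - y) (gC _ _) (gC _ _))))
  (fun w a u => gZ a u w)
  (fun w a u => etrans (gC _ _) (etrans (gZ a u w) (congr1 ( *%R a) (gC _ _)))).
pose herm := isHermitianSesquilinear.Build R V false idfun g
  (fun u v => etrans (gC u v) (esym (mul1r _))).
pose pos := isDotProduct.Build R V g g_gt0.
pose G : {dot V for idfun} := HB.pack_for {dot V for idfun} g bil herm pos.
by exists G.
Qed.

Variable g : {dot V for idfun}.

Lemma dotC u v : g u v = g v u.
Proof. by rewrite [LHS]hermitian_subproof mul1r. Qed.

Lemma dotDl u v w : g (u + v) w = g u w + g v w. Proof. exact: linearDl. Qed.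
Lemma dotDr u v w : g w (u + v) = g w u + g w v. Proof. exact: linearDr. Qed.
Lemma dotBl u v w : g (u - v) w = g u w - g v w. Proof. exact: linearBl. Qed.
Lemma dotBr u v w : g w (u - v) = g w u - g w v. Proof. exact: linearBr. Qed.
Lemma dotZl a u w : g (a *: u) w = a * g u w. Proof. exact: linearZl_LR. Qed.
Lemma dotZr a u w : g w (a *: u) = a * g w u. Proof. exact: linearZr_LR. Qed.
Lemma dot0l w : g 0 w = 0. Proof. exact: linear0l. Qed.

Definition dotE := (dotBl, dotBr, dotDl, dotDr, dotZl, dotZr).

Lemma dot_gt0 u : u != 0 -> 0 < g u u.
Proof. exact: neq0_dnorm_gt0. Qed.

Lemma dot_separates u v : (forall w, g u w = g v w) -> u = v.
Proof.
move=> uv; apply/eqP; rewrite -subr_eq0; apply/negPn/negP => /dot_gt0.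
by rewrite dotBl uv subrr ltxx.
Qed.

(** The first prolongation of the conformal algebra: this is the computation of
    the Levi-Civita connection of a conformally flat metric by the Koszul
    formula, [al] being the derivative of the logarithm of the factor. *)
Lemma conformal_prolongation (B : V -> V -> V) (al : V -> R) (u0 : V) :
  u0 != 0 -> (forall u v, B u v = B v u) ->
  (forall u v w, g (B u v) w + g v (B u w) = 2 * al u * g v w) ->
  exists2 a, forall w, g a w = al w
    & forall u v, B u v = al u *: v + al v *: u - g u v *: a.
Proof.
move=> u0_neq0 BC gB.
have koszul u v w : g (B u v) w = al u * g v w + al v * g u w - al w * g u v.
  have := gB u v w; have := gB v w u; have := gB w u v.
  rewrite (BC w v) (BC w u) (BC v u) (dotC (B v w) u) (dotC v (B u w)).
  by rewrite (dotC w (B u v)) (dotC w u); lra.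
have g0 : g u0 u0 != 0 by rewrite gt_eqF ?dot_gt0.
(* Solving the formula at [u = v = u0] for the gradient of [al]. *)
pose a := (g u0 u0)^-1 *: (2 * al u0 *: u0 - B u0 u0).
have ga w : g a w = al w by rewrite /a !dotE koszul; field.
clearbody a; exists a => // u v; apply: dot_separates => w.
by rewrite koszul !dotE ga; ring.
Qed.

End InnerProduct.

Section InvariantInnerProduct.
Variables (R : realType) (V : finNormedModType R).

(** In coordinates, the linear isometries of a Minkowski norm form a bounded
    group of matrices. *)
Lemma invariant_dot (F : V -> R) : minkowski_norm F ->
  exists g : {dot V for idfun}, forall M : {linear V -> V},
    (forall v, F (M v) = F v) -> forall u v, g (M u) (M v) = g u v.
Proof.
move=> mF; have [_ _ _ F_eq0] := mF.
have [K K0 FK] := minkowski_le_coord mF.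
have [D D0 FD] := coord_le_minkowski mF.
pose G := [set A : 'M[R]_(dim V) |
  forall x : 'rV_(dim V), F (r2v (x *m A)) = F (r2v x)].
have [|M N GM GN x|M GM|M GM|q [qT q_gt0 qG]] :=
    @bounded_group_preserves_form R (dim V) G (D * K).
- by move=> x; rewrite mulmx1.
- by rewrite mulmxA GN GM.
- have uM : M \in unitmx.
    rewrite -row_free_unit; apply: inj_row_free => x xM0.
    apply: (@r2v_inj _ V); rewrite linear0; apply: F_eq0.
    by rewrite -GM xM0 linear0 minkowski0.
  exists (invmx M); last exact: mulVmx.
  by move=> x; rewrite -[LHS]GM mulmxKV.
- apply: mx_norm_le => [|i j]; first by rewrite mulr_ge0// ltW.
  have -> : M i j = row i M 0 j by rewrite mxE.
  rewrite rowE.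
  rewrite (le_trans (entry_le_mx_norm _ _ _))//.
  rewrite -[X in `|X|](@r2vK _ V) (le_trans (FD _))// GM.
  rewrite ler_pM2l// (le_trans (FK _))// r2vK.
  rewrite -[leRHS]mulr1 ler_pM2l//; apply: mx_norm_le => // k l.
  by rewrite mxE; case: (_ && _); rewrite ?normr1 ?normr0.
pose f (u v : V) := (v2r u *m q *m (v2r v)^T) 0 0.
have [a u v w|u v|u u0|g gE] := @dot_of_form R V f.
- by rewrite /f linearP !mulmxDl -!scalemxAl !mxE.
- transitivity ((v2r u *m q *m (v2r v)^T)^T 0 0); first by rewrite [RHS]mxE.
  by rewrite !trmx_mul trmxK qT mulmxA.
- by apply: q_gt0; rewrite -(inj_eq (can_inj (@r2vK _ V))) v2rK linear0.
exists g => M FM u v.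
pose A := lin1_mx (v2r \o M \o r2v).
have vM w : v2r (M w) = v2r w *m A by rewrite mul_rV_lin1/= v2rK.
have GA : G A by move=> x; rewrite mul_rV_lin1/= v2rK FM.
by rewrite !gE /f !vM trmx_mul !mulmxA -(mulmxA _ A) -(mulmxA _ (A *m q)) qG.
Qed.

End InvariantInnerProduct.

(** * Curves in the level sets of a Minkowski norm *)

Lemma is_derive_cvg (R : realType) (V W : normedModType R) (f : V -> W) x v df :
  is_derive x v f df <->
    h^-1 *: (f (h *: v + x) - f x) @[h --> (0 : R)^'] --> df.
Proof.
split=> [[f_x <-]|fdf]; first exact: f_x.
by split; [exact: cvgP fdf|exact: cvg_lim fdf].
Qed.

Section DirectionalDerivatives.
Variables (R : realType) (V W : normedModType R).

Lemma is_derive_scale (k : V -> R) (f : V -> W) x v dk df :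
  is_derive x v k dk -> is_derive x v f df ->
  is_derive x v (fun y => k y *: f y) (dk *: f x + k x *: df).
Proof.
move=> /is_derive_cvg kdk fdf; apply/is_derive_cvg.
have fc : f (h *: v + x) @[h --> (0 : R)^'] --> f x.
  have fc : {for (0 : R), continuous (fun h : R => f (h *: v + x))}.
    apply/differentiable_continuous/derivable1_diffP.
    by apply: (derivable1P f x v).1; exact: ex_derive.
  move: fc; rewrite /prop_for /continuous_at scale0r add0r; apply: cvg_trans.
  by apply: cvg_app; exact: cvg_within.
rewrite (_ : (fun _ => _) = fun h => (h^-1 *: (k (h *: v + x) - k x)) *:
    f (h *: v + x) + k x *: (h^-1 *: (f (h *: v + x) - f x))).
  apply: cvgD; first exact: cvgZ kdk fc.
  by apply: cvgZl_tmp; exact/is_derive_cvg.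
apply/funext => h; rewrite scalerA mulrC -!scalerA -scalerDr; congr (_ *: _).
by rewrite scalerBl scalerBr addrA subrK.
Qed.

Lemma is_derive_linear_comp (U : normedModType R) (l : {linear W -> U})
    (f : V -> W) x v df : continuous l ->
  is_derive x v f df -> is_derive x v (l \o f) (l df).
Proof.
move=> lc /is_derive_cvg fdf; apply/is_derive_cvg.
rewrite (_ : (fun _ => _) =
    l \o (fun h : R => h^-1 *: (f (h *: v + x) - f x))).
  by apply: continuous_cvg => //; exact: lc.
by apply/funext => h; rewrite [RHS]linearZ [X in _ = _ *: X]linearB.
Qed.

End DirectionalDerivatives.

Section Levels.
Variables (R : realType) (V : finNormedModType R) (F : V -> R).
Hypothesis mF : minkowski_norm F.

Lemma minkowski_lipschitz :
  exists2 K, 0 < K & forall u v, `|F u - F v| <= K * `|u - v|.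
Proof.
have [K K0 FK] := minkowski_le_norm mF; have [_ _ FD _] := mF.
have flip u v : F u - F v <= K * `|u - v|.
  rewrite lerBlDr (le_trans _ (lerD (FK _) (lexx _)))//.
  by rewrite (le_trans _ (FD _ _))// subrK.
exists K => // u v; rewrite ler_norml flip andbT lerNl opprB distrC.
exact: flip.
Qed.

(** [F] need not be differentiable, so the tangency of the vector field [C] to
    the level sets of [F] is expressed by curves inside these sets. *)
Definition tangent_to_levels (C : V -> V) := forall u, exists mu : R -> V,
  [/\ mu 0 = u, is_derive (0 : R) 1 mu (C u)
    & \forall h \near 0, F (mu h) = F u].

(** Along an integral curve [c] of [C], the curve given by tangency at [c s]
    agrees with [c] to first order; as [F] is Lipschitz, the derivative of
    [F \o c] exists and is zero. *)
Lemma flow_preserves_levels (C : V -> V) (c : R -> V) :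
  tangent_to_levels C -> (forall s : R, is_derive s 1 c (C (c s))) ->
  forall s t, F (c s) = F (c t).
Proof.
move=> tC cC s t; apply: (@is_derive_0_is_cst _ (F \o c)) => {t}x.
apply/is_derive_cvg.
have [K K0 FK] := minkowski_lipschitz.
have [mu [mu0 /is_derive_cvg dmu Fmu]] := tC (c x).
have /is_derive_cvg dc := cC x.
have := cvgB dc dmu; rewrite subrr => /(_ _) d0.
apply/cvgr0Pnorm_lt => e e0.
have /cvgr0Pnorm_lt/(_ (e / K) (divr_gt0 e0 K0)) small := d0; near=> h.
rewrite normrZ /=.
have -> : F (c x) = F (mu h).
  by apply/esym; near: h; apply: cvg_within; exact: Fmu.
apply: (@le_lt_trans _ _ (K * `|h^-1 *: (c (h *: 1 + x) - mu h)|)).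
  by rewrite normrZ mulrCA ler_wpM2l.
rewrite mulrC -ltr_pdivlMr//.
have -> : h^-1 *: (c (h *: 1 + x) - mu h) =
    h^-1 *: (c (h *: 1 + x) - c x) - h^-1 *: (mu (h *: 1 + 0) - mu 0).
  by rewrite -scalerBr mu0 opprB addrA subrK addr0 [h *: 1]mulr1.
near: h; exact: small.
Unshelve. all: by end_near. Qed.

End Levels.

(** * Norms invariant under rotations *)

Section Rotations.
Variables (R : realType) (V : finNormedModType R) (F : V -> R).
Variable g : {dot V for idfun}.

Lemma orthogonal_vector (a : V) : a != 0 -> (2 <= \dim {:V})%N ->
  exists2 v, v != 0 & g a v = 0.
Proof.
move=> a0 dimV; have gaa : g a a != 0 by rewrite gt_eqF ?dot_gt0.
have [w wa] : exists w, w \notin <[a]>%VS.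
  apply: contrapT => /forallNP aV.
  suff /dimvS : (fullv <= <[a]>)%VS by rewrite dim_vline a0 leqNgt dimV.
  by apply/subvP => w _; apply/negPn/negP => /aV.
exists (w - (g a w / g a a) *: a); last by rewrite !dotE; field.
apply: contra wa; rewrite subr_eq0 => /eqP ->.
by rewrite memvZ// memv_line.
Qed.

(** The skew-symmetric endomorphism that generates the rotations in the plane
    of [a] and [v]. *)
Let rotation_generator (a v w : V) : V := g a w *: v - g v w *: a.

(** Every vector of the [g]-sphere through [a] lies on a great circle through
    [a]; [F] is constant along that circle. *)
Lemma rotations_euclidean (a : V) :
  minkowski_norm F -> a != 0 -> (2 <= \dim {:V})%N ->
  (forall v, tangent_to_levels F (rotation_generator a v)) ->
  euclidean F.
Proof.
move=> mF a0 dimV tF; have [F0 FZ _ _] := mF.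
have gaa : 0 < g a a by exact: dot_gt0.
have circle v t : g a v = 0 -> g v v = g a a ->
    F (cos t *: a + sin t *: v) = F a.
  move=> gav gvv; set r := g a a in gaa gvv *.
  pose c (s : R) := cos (r * s) *: a + sin (r * s) *: v.
  have dc (s : R) : is_derive s 1 c (rotation_generator a v (c s)).
    have ds : is_derive s 1 ( *%R r : R -> R) r.
      by apply: is_derive_eq; rewrite scaler1.
    have dcos := is_derive1_comp (is_derive_cos (r * s)) ds.
    have dsin := is_derive1_comp (is_derive_sin (r * s)) ds.
    have := is_deriveD (is_derive_scale dcos (is_derive_cst a s 1))
                       (is_derive_scale dsin (is_derive_cst v s 1)).
    move=> H; apply: (is_derive_eq H); rewrite !scaler0 !addr0.
    rewrite /rotation_generator /c !dotE (dotC g v a) gav gvv -/r.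
    by rewrite !mulr0 addr0 add0r mulNr scaleNr addrC.
  have := flow_preserves_levels mF (tF v) dc (t / r) 0.
  by rewrite /c mulrC divfK ?gt_eqF// mulr0 cos0 sin0 scale1r scale0r addr0.
have sphere w : g w w = g a a -> F w = F a.
  move=> gww; pose t := g a w / g a a; pose w' := w - t *: a.
  have gaw' : g a w' = 0 by rewrite /w' !dotE /t; field; rewrite gt_eqF.
  have gw' : g w' w' = (1 - t ^+ 2) * g a a.
    rewrite /w' !dotE (dotC g w a) gww.
    have -> : g a w = t * g a a by rewrite /t divfK ?gt_eqF.
    by ring.
  (* When [w] is [a] or [- a] it does not determine a great circle, and any
     vector orthogonal to [a] serves. *)
  have [v [s [gav gvv s0 w'E]]] : exists v s,
      [/\ g a v = 0, g v v = g a a, 0 <= s & w' = s *: v].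
    have normalise u : u != 0 -> g a u = 0 ->
        let v := Num.sqrt (g a a / g u u) *: u in g a v = 0 /\ g v v = g a a.
      move=> u0 gau v; rewrite /v !dotE gau mulr0; split=> //.
      have guu : 0 < g u u by exact: dot_gt0.
      by rewrite mulrA -expr2 sqr_sqrtr ?divr_ge0 1?ltW// divfK// gt_eqF.
    have [w'0|w'0] := eqVneq w' 0.
      have [u u0 gau] := orthogonal_vector a0 dimV.
      have [gav gvv] := normalise u u0 gau.
      by eexists; exists 0; split; [exact: gav|exact: gvv| |rewrite scale0r].
    have [gav gvv] := normalise w' w'0 gaw'.
    have q0 : 0 < Num.sqrt (g a a / g w' w').
      by rewrite sqrtr_gt0 divr_gt0// dot_gt0.
    eexists; exists (Num.sqrt (g a a / g w' w'))^-1.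
    split; [exact: gav|exact: gvv|by rewrite invr_ge0 ltW|].
    by rewrite scalerA mulVf ?scale1r// gt_eqF.
  have st : s ^+ 2 = 1 - t ^+ 2.
    apply: (@mulIf _ (g a a)); first by rewrite gt_eqF.
    by rewrite -gw' w'E !dotE gvv mulrA.
  have t1 : -1 <= t <= 1.
    rewrite -ler_norml -(@expr_le1 _ 2)// real_normK ?num_real//.
    by rewrite -subr_ge0 -st sqr_ge0.
  rewrite -(circle v (acos t) gav gvv) acosK ?in_itv//= sin_acos//.
  by rewrite -st sqrtr_sqr ger0_norm// -w'E /w' addrC subrK.
have Fa : 0 < F a.
  rewrite lt_neqAle F0 andbT eq_sym; apply: contra a0 => /eqP.
  by have [_ _ _ F_eq0] := mF => /F_eq0 ->.
pose k := F a ^+ 2 / g a a; have k_gt0 : 0 < k by rewrite divr_gt0// exprn_gt0.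
have [b u v w|u v|u u0|G GE] := @dot_of_form R V (fun u v => k * g u v).
- by rewrite !dotE; ring.
- by rewrite dotC.
- by rewrite mulr_gt0// dot_gt0.
exists G => w; rewrite GE.
have [->|w0] := eqVneq w 0; first by rewrite minkowski0// dot0l mulr0 sqrtr0.
have gww : 0 < g w w by exact: dot_gt0.
pose l := Num.sqrt (g a a / g w w).
have l0 : 0 < l by rewrite sqrtr_gt0 divr_gt0.
have l2 : l ^+ 2 = g a a / g w w by rewrite sqr_sqrtr// divr_ge0// ltW.
have /sphere : g (l *: w) (l *: w) = g a a.
  by rewrite !dotE mulrA -expr2 l2 divfK// gt_eqF.
rewrite FZ ?ltW// => lF.
have -> : k * g w w = (F w) ^+ 2.
  rewrite /k -lF exprMn l2; field; by rewrite !gt_eqF.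
by rewrite sqrtr_sqr ger0_norm.
Qed.

End Rotations.

(** * Second differentials and vanishing differentials *)

Section DifferentialCalculus.
Variables (R : realType) (V : normedModType R).

Lemma diff_is_derive (W : normedModType R) (f : V -> W) x v :
  differentiable f x -> is_derive x v f ('d f x v).
Proof. by move=> df; split; [exact: diff_derivable|exact: deriveE]. Qed.

Lemma is_derive_line (W : normedModType R) (f : V -> W) x v (s : R) df :
  is_derive (x + s *: v) v f df -> is_derive s 1 (fun t => f (x + t *: v)) df.
Proof.
move=> /is_derive_cvg fdf; apply/is_derive_cvg.
rewrite (_ : (fun _ => _) =
    fun h : R => h^-1 *: (f (h *: v + (x + s *: v)) - f (x + s *: v))) //.
by apply/funext => h; rewrite scalerDl [h *: 1]mulr1 addrCA.
Qed.

Variable W : finNormedModType R.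

(** A vector-valued curve satisfies the mean value theorem only after
    composition with a linear functional. *)
Lemma mean_value_functional (l : {linear W -> R^o}) (c c' : R -> W) :
  (forall s : R, 0 <= s <= 1 -> is_derive s 1 c (c' s)) ->
  exists2 s : R, 0 <= s <= 1 & l (c 1 - c 0) = l (c' s).
Proof.
move=> dc.
have dlc (s : R) : 0 <= s <= 1 -> is_derive s 1 (l \o c : R -> R) (l (c' s)).
  by move=> /dc; exact/is_derive_linear_comp/linear_fin_continuous.
have [s||s s01] := @MVT R (l \o c) (l \o c') 0 1 ltr01.
- by rewrite in_itv/= => /andP[s0 s1]; apply: dlc; rewrite !ltW.
- apply: continuous_in_subspaceT => s; rewrite inE/= in_itv/= => s01.
  have [dlcs _] := dlc s s01.
  exact/differentiable_continuous/derivable1_diffP.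
rewrite subr0 mulr1 /= -linearB => E; exists s => //.
by move: s01; rewrite in_itv/= => /andP[s0 s1]; rewrite !ltW.
Qed.

Lemma eq_functionals (w w' : W) :
  (forall l : {linear W -> R^o}, l w = l w') -> w = w'.
Proof.
move=> ww'; rewrite (coord_vbasis (memvf w)) (coord_vbasis (memvf w')).
by apply: eq_bigr => i _; rewrite (ww' (coord (vbasis fullv) i)).
Qed.

(** The mean value theorem turns the second difference into [h] times a first
    difference of the partial differential in direction [u], whose first-order
    expansion at [x] gives the term [h ^+ 2]. *)
Lemma second_difference (l : {linear W -> R^o}) (f : V -> W) x u v :
  (\forall y \near x, differentiable f y) ->
  differentiable (fun y => 'd f y u) x ->
  forall e, 0 < e -> \forall h \near 0^'+,
    `|l (f (x + h *: u + h *: v) - f (x + h *: u) - f (x + h *: v) + f x)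
      - h ^+ 2 * l ('d (fun y => 'd f y u) x v)| <= e * h ^+ 2.
Proof.
move=> df ddf e e0; set G := fun y => 'd f y u.
have [k k0 lk] := linear_lipschitz (@linear_fin_continuous _ _ _ l).
pose M := `|u| + `|v| + 1.
have M0 : 0 < M by rewrite ltr_wpDl// addr_ge0.
pose eps := e / (2 * k * M).
have eps0 : 0 < eps by rewrite divr_gt0// !mulr_gt0.
have /eqaddoP/(_ eps eps0) := diff_locally ddf.
move=> /nbhs_ballP[d1 /= d1_gt0 d1G].
have /nbhs_ballP[d2 /= d2_gt0 d2f] := df.
have small z : `|z| < d1 -> `|G (x + z) - G x - 'd G x z| <= eps * `|z|.
  move=> zd; have := d1G z; rewrite -ball_normE/= sub0r normrN => /(_ zd).
  have -> : G (x + z) - G x - 'd G x z = G (z + x) - (G x + 'd G x z).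
    by rewrite opprD addrA (addrC z).
  exact.
near=> h.
have h0 : 0 < h by [].
have hM1 : h * M < d1.
  by rewrite -ltr_pdivlMr//; near: h; apply: nbhs_right_lt; exact: divr_gt0.
have hM2 : h * M < d2.
  by rewrite -ltr_pdivlMr//; near: h; apply: nbhs_right_lt; exact: divr_gt0.
have size_ (s t : R) : 0 <= s <= 1 -> 0 <= t <= 1 ->
    `|t *: (h *: v) + s *: (h *: u)| <= h * M.
  move=> /andP[s0 s1] /andP[t0 t1]; rewrite (le_trans (ler_normD _ _))//.
  rewrite !normrZ !ger0_norm// 1?ltW//.
  have hu : s * (h * `|u|) <= h * `|u| by rewrite ler_piMl// mulr_ge0// ltW.
  have hv : t * (h * `|v|) <= h * `|v| by rewrite ler_piMl// mulr_ge0// ltW.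
  by rewrite /M; nra.
(* The side of the parallelogram that the mean value theorem runs along is
   [y 1] for the far side and [y 0] for the near one. *)
pose y t s := x + (t *: (h *: v) + s *: (h *: u)).
have dfy (s t : R) : 0 <= s <= 1 -> 0 <= t <= 1 -> differentiable f (y t s).
  move=> s01 t01; apply: d2f; rewrite -ball_normE/= /y opprD addNKr normrN.
  exact: le_lt_trans (size_ _ _ s01 t01) hM2.
have [s s01|s s01] := @mean_value_functional l
    (fun s => f (x + h *: v + s *: (h *: u)) - f (x + s *: (h *: u)))
    (fun s => 'd f (y 1 s) (h *: u) - 'd f (y 0 s) (h *: u)).
  apply: is_deriveB; apply/is_derive_line.
    have -> : x + h *: v + s *: (h *: u) = y 1 s by rewrite /y scale1r addrA.
    by apply/diff_is_derive/dfy; rewrite ?lexx ?ler01.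
  have -> : x + s *: (h *: u) = y 0 s by rewrite /y scale0r add0r.
  by apply/diff_is_derive/dfy; rewrite ?lexx ?ler01.
rewrite !scale1r !scale0r !addr0 => lE.
have -> : f (x + h *: u + h *: v) - f (x + h *: u) - f (x + h *: v) + f x =
    f (x + h *: v + h *: u) - f (x + h *: u) - (f (x + h *: v) - f x).
  by rewrite (addrAC x (h *: u)) [in RHS]opprD opprK [in RHS]addrA.
rewrite lE (_ : _ - _ = h *: (G (y 1 s) - G (y 0 s))); last first.
  by rewrite /G scalerBr !linearZ.
rewrite linearZ/=.
have GE t : 0 <= t <= 1 ->
    `|G (y t s) - G x - 'd G x (t *: (h *: v) + s *: (h *: u))|
      <= eps * (h * M).
  move=> t01; have sz := size_ s t s01 t01.
  rewrite (le_trans (small _ _))//; first exact: le_lt_trans hM1.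
  by rewrite ler_pM2l.
have cancel (a b c d p : W) : a - b - (p + c) - (d - b - c) = a - d - p.
  rewrite -[a - b - _]addrA -opprD addrCA opprD addrA.
  by rewrite -[d - b - c]addrA -opprD opprB addrA subrK addrAC.
have -> : h *: l (G (y 1 s) - G (y 0 s)) - h ^+ 2 * l ('d G x v) =
    h * l ((G (y 1 s) - G x - 'd G x (1 *: (h *: v) + s *: (h *: u)))
      - (G (y 0 s) - G x - 'd G x (0 *: (h *: v) + s *: (h *: u)))).
  rewrite scale1r scale0r add0r (linearD ('d G x)) cancel.
  rewrite ['d G x (h *: v)]linearZ.
  rewrite [X in h * X](linearB l) [l (h *: _)]linearZ.
  by rewrite [RHS]mulrBr expr2 -mulrA.
rewrite normrM gtr0_norm// expr2 mulrCA ler_pM2l//.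
rewrite (le_trans (lk _))//.
have := le_trans (ler_normB _ _) (lerD (GE 1 _) (GE 0 _)).
rewrite !lexx !ler01 => /(_ isT isT) H.
have : k * (eps * (h * M) + eps * (h * M)) = e * h.
  by rewrite /eps; field; rewrite !gt_eqF.
move=> <-; by rewrite ler_pM2l.
Unshelve. all: by end_near. Qed.


(** The second difference is symmetric in [u] and [v]. *)
Lemma second_derivative_symmetric (f : V -> W) x u v :
  (\forall y \near x, differentiable f y) ->
  (forall w, differentiable (fun y => 'd f y w) x) ->
  'd (fun y => 'd f y u) x v = 'd (fun y => 'd f y v) x u.
Proof.
move=> df ddf; apply: eq_functionals => l; apply/eqP.
rewrite -subr_eq0 -normr_le0; apply/ler_addgt0Pr => e e0; rewrite add0r.
have e20 : 0 < e / 2 by exact: divr_gt0.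
near (0 : R)^'+ => h.
have h0 : 0 < h by [].
have Huv := near (second_difference l v df (ddf u) e20) h.
have Hvu := near (second_difference l u df (ddf v) e20) h.
rewrite -(@ler_pM2r _ (h ^+ 2)) ?exprn_gt0//.
rewrite -[X in _ * X]gtr0_norm ?exprn_gt0// -normrM mulrBl.
set A := l (_ - _ - _ + _) in Huv *; set B := l ('d (fun y => 'd f y u) x v).
set C := l (_ - _ - _ + _) in Hvu *.
set D := l ('d (fun y => 'd f y v) x u).
have -> : B * h ^+ 2 - D * h ^+ 2 = (C - h ^+ 2 * D) - (A - h ^+ 2 * B).
  have -> : A = C by rewrite /A /C (addrAC x) [X in l (X + _)]addrAC.
  by ring.
rewrite (le_trans (ler_normB _ _))// (le_trans (lerD (Hvu _) (Huv _)))//.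
by rewrite -mulrDl -splitr.
Unshelve. all: by end_near. Qed.

Lemma zero_diff_constant (U : set V) (f : V -> W) : open U -> connected U ->
  (forall x, U x -> differentiable f x) ->
  (forall x v, U x -> 'd f x v = 0) ->
  forall x y, U x -> U y -> f x = f y.
Proof.
move=> oU cU df df0 x y Ux Uy.
have loc z : U z -> \forall z' \near z, U z' /\ f z' = f z.
  move=> Uz; have : nbhs z U by exact: open_nbhs_nbhs.
  move=> /nbhs_ballP[e /= e0 zeU]; apply/nbhs_ballP; exists e => // z' zz'.
  split; first exact: zeU.
  apply: eq_functionals => l; apply/eqP; rewrite -subr_eq0 -linearB.
  have segU (s : R) : 0 <= s <= 1 -> U (z + s *: (z' - z)).
    move=> /andP[s0 s1]; apply: zeU; move: zz'.
    rewrite -ball_normE/= opprD addNKr normrN normrZ distrC ger0_norm// => zz'.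
    by rewrite (le_lt_trans _ zz')// ler_piMl.
  have [s s01|s s01] := @mean_value_functional l
      (fun s => f (z + s *: (z' - z)))
      (fun s => 'd f (z + s *: (z' - z)) (z' - z)).
    exact/is_derive_line/diff_is_derive/df/segU.
  rewrite scale1r scale0r addr0 (addrC z) subrK => ->.
  by rewrite df0 ?linear0//; exact: segU.
have : [set z | U z /\ f z = f x] = U.
  apply: cU; first by exists x.
    exists [set z | U z /\ f z = f x].
      rewrite openE => z [Uz fz]; rewrite /interior.
      near=> z'; have [] : U z' /\ f z' = f z; first by near: z'; exact: loc.
      by rewrite fz.
    by apply/seteqP; split=> [z [Uz fz]|z []].
  exists (~` [set z | U z /\ f z != f x]).
    apply: open_closedC; rewrite openE => z [Uz fz]; rewrite /interior.
    near=> z'; have [] : U z' /\ f z' = f z; first by near: z'; exact: loc.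
    by move=> Uz' fz'; split=> //; rewrite fz'.
  apply/seteqP; split=> [z [Uz fz]|z [Uz fz]].
    by split=> // -[_]; rewrite fz eqxx.
  by split=> //; apply/eqP/negPn/negP => fzx; apply: fz.
by move=> E; have [] : [set z | U z /\ f z = f x] y by rewrite E.
Unshelve. all: by end_near. Qed.

End DifferentialCalculus.

(** * Conformal maps between Minkowski spaces *)

Lemma is_derive_dot (R : realType) (V : normedModType R)
    (W : finNormedModType R) (g : {dot W for idfun}) (a b : V -> W) x v da db :
  is_derive x v a da -> is_derive x v b db ->
  is_derive x v (fun y => g (a y) (b y)) (g da (b x) + g (a x) db).
Proof.
move=> a_da b_db; pose e := vbasis (fullv : {vspace W}).
have gE u w : g u w = \sum_i coord e i u * g e`_i w.
  rewrite {1}(coord_vbasis (memvf u)).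
  rewrite (big_morph (g^~ w) (fun y z => dotDl g y z w) (dot0l g w)).
  by apply: eq_bigr => i _; rewrite dotZl.
have dg i : is_derive x v (fun y => g e`_i (b y)) (g e`_i db).
  pose l : W -> R^o := g e`_i.
  have l_linear : linear l by move=> k u w; rewrite /l dotDr dotZr.
  pose ll : {linear W -> R^o} :=
    HB.pack l (GRing.isLinear.Build _ _ _ _ l l_linear).
  exact: (is_derive_linear_comp (@linear_fin_continuous _ _ _ ll) b_db).
have dc i : is_derive x v (fun y => coord e i (a y) : R) (coord e i da).
  exact: is_derive_linear_comp (@linear_fin_continuous _ _ _ (coord e i)) a_da.
have := is_derive_sum (fun i => is_deriveM (dc i) (dg i)).
rewrite (_ : \sum_i _ = fun y => g (a y) (b y)); last first.
  by apply/funext => y; rewrite fct_sumE gE.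
move=> H; apply: (is_derive_eq H); rewrite gE (gE (a x)) -big_split.
by apply: eq_bigr => i _ /=; rewrite addrC; congr (_ + _); exact: mulrC.
Qed.

Lemma injective_linear_inverse (K : fieldType) (V1 V2 : vectType K)
    (A : {linear V1 -> V2}) :
  \dim {:V1} = \dim {:V2} -> (forall v, A v = 0 -> v = 0) ->
  exists L : {linear V2 -> V1}, cancel A L /\ cancel L A.
Proof.
move=> dimE Ainj; pose h := linfun A.
have hE v : h v = A v by exact: lfunE.
have h0 : lker h == 0%VS.
  rewrite -subv0; apply/subvP => v; rewrite memv_ker lfunE/= memv0.
  by move=> /eqP/Ainj ->.
have hfull : limg h = fullv.
  by apply/eqP; rewrite eqEdim subvf limg_dim_eq ?dimE//= (eqP h0) capv0.
exists (h^-1)%VF; split=> v.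
  by rewrite -hE; exact: lker0_lfunK.
by rewrite -hE; apply: limg_lfunVK; rewrite hfull memvf.
Qed.

Section ConformalMaps.
Variables (R : realType) (V1 V2 : finNormedModType R).
Variables (F1 : V1 -> R) (F2 : V2 -> R) (U : set V1) (f : V1 -> V2).
Variable lambda : V1 -> R.
Hypotheses (dimV1 : (2 <= \dim {:V1})%N) (dimE : \dim {:V1} = \dim {:V2}).
Hypotheses (mF1 : minkowski_norm F1) (mF2 : minkowski_norm F2).
Hypothesis F1_non_euclidean : ~ euclidean F1.
Hypothesis openU : open U.
Hypothesis df : forall x, U x -> differentiable f x.
Hypothesis ddf : forall x v, U x -> differentiable (fun y => 'd f y v) x.
Hypothesis lambda_gt0 : forall x, U x -> 0 < lambda x.
Hypothesis f_conformal : conformal_factor F1 F2 U f lambda.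

Lemma diff_conformal_inverse x : U x ->
  exists L : {linear V2 -> V1}, cancel ('d f x) L /\ cancel L ('d f x).
Proof.
move=> Ux; apply: injective_linear_inverse => // v fv0.
have [_ _ _ F1_eq0] := mF1; apply: F1_eq0.
have := f_conformal Ux v; rewrite fv0 minkowski0// => /esym/eqP.
by rewrite mulf_eq0 gt_eqF ?lambda_gt0//= => /eqP.
Qed.

(** Normalising the differentials by [T y := ('d f x)^-1 \o 'd f y], the maps
    [T y] are, up to the factor [lambda y / lambda x], isometries of [F1] and
    hence of an inner product [g].  Their derivative [B] at [x] is therefore a
    symmetric bilinear map with values in the conformal algebra of [g], and is
    determined by the derivative [al] of the factor.  The part of [B] that
    preserves [F1] infinitesimally generates the rotations in all planes that
    contain the gradient of [al], which must vanish if [F1] is not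
    Euclidean. *)
Lemma second_diff_conformal x u v : U x -> 'd (fun y => 'd f y u) x v = 0.
Proof.
move=> Ux; have [F1_ge0 F1Z _ F1_eq0] := mF1.
have [L [AL LA]] := diff_conformal_inverse Ux.
have [g gP] := invariant_dot mF1.
pose T y w := L ('d f y w).
have T_x w : T x w = w by rewrite /T AL.
have F1T y w : U y -> F1 (T y w) = lambda y / lambda x * F1 w.
  move=> Uy; have := f_conformal Ux (T y w); rewrite /T LA f_conformal//.
  by move=> E; rewrite mulrAC E mulrAC mulfV ?mul1r// gt_eqF// lambda_gt0.
have gT y w w' : U y ->
    g (T y w) (T y w') = (lambda y / lambda x) ^+ 2 * g w w'.
  move=> Uy; set r := lambda y / lambda x.
  have r0 : 0 < r by rewrite divr_gt0// lambda_gt0.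
  pose M : {linear V1 -> V1} := r^-1 \*: (L \o 'd f y).
  have <- := gP M _ w w'.
    by rewrite /M/= !dotE /T; field; rewrite gt_eqF.
  move=> z; rewrite /M/= F1Z ?invr_ge0 ?ltW// -[L _]/(T y z) F1T// -/r.
  by rewrite mulKf// gt_eqF.
pose B v w := L ('d (fun y => 'd f y w) x v).
have nearU w : \forall t \near (0 : R), U (x + t *: w).
  have : x + t *: w @[t --> (0 : R)] --> x + 0 *: w.
    by apply: cvgD; [exact: cvg_cst|apply: cvgZr_tmp; exact: cvg_id].
  rewrite scale0r addr0; apply; exact: open_nbhs_nbhs.
have dT w z : is_derive (0 : R) 1 (fun t => T (x + t *: w) z) (B w z).
  apply: (@is_derive_line _ _ _ (fun y => T y z) x w 0); rewrite scale0r addr0.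
  apply: (@is_derive_linear_comp _ _ _ _ L (fun y => 'd f y z)).
    exact: linear_fin_continuous.
  exact/diff_is_derive/ddf.
(* [lambda] is compared with the smooth function [y |-> g (T y e) (T y e)];
   this makes it differentiable although [F1] and [F2] need not be. *)
have [e e0] : exists e : V1, e != 0.
  exists (vpick fullv); rewrite vpick0; apply: contraTneq dimV1 => ->.
  by rewrite dimv0.
have gee : 0 < g e e by exact: dot_gt0.
pose r w t := Num.sqrt (g (T (x + t *: w) e) (T (x + t *: w) e) / g e e).
have rE w : \forall t \near (0 : R), r w t = lambda (x + t *: w) / lambda x.
  near=> t; have Ut : U (x + t *: w) by near: t; exact: nearU.
  rewrite /r gT// mulfK ?gt_eqF// sqrtr_sqr gtr0_norm//.
  by rewrite divr_gt0// lambda_gt0.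
have r0 w : r w 0 = 1.
  by rewrite /r scale0r addr0 !T_x mulfV ?sqrtr1// gt_eqF.
pose al w := g (B w e) e / g e e.
have dr w : is_derive (0 : R) 1 (r w) (al w).
  pose q t : R := g (T (x + t *: w) e) (T (x + t *: w) e) / g e e.
  have q0 : q 0 = 1.
    by rewrite /q scale0r addr0 T_x mulfV// gt_eqF.
  have dq : is_derive (0 : R) 1 q (2 * al w).
    have := is_derive_scale (is_derive_dot g (dT w e) (dT w e))
      (is_derive_cst ((g e e)^-1 : R^o) (0 : R) 1).
    rewrite scaler0 addr0 scale0r addr0 T_x (dotC g e (B w e)) -mulr2n => H.
    apply: (is_derive_eq H).
    by rewrite -[LHS]/(_ *+ 2 * (g e e)^-1) /al mulr_natl mulrnAl.
  have dsqrt : is_derive (q 0) 1 Num.sqrt (2 * Num.sqrt (q 0))^-1.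
    by apply: is_derive1_sqrt; rewrite q0.
  apply: (is_derive_eq (is_derive1_comp dsqrt dq)).
  by rewrite q0 sqrtr1 mulr1 mulKf.
have gB w y z : g (B w y) z + g y (B w z) = 2 * al w * g y z.
  have H1 := is_derive_dot g (dT w y) (dT w z).
  have H2 : is_derive (0 : R) 1 (fun t => r w t ^+ 2 * g y z)
      (2 * al w * g y z).
    have dc := is_derive_cst (g y z : R^o) (0 : R) 1.
    have := is_derive_scale (dr w) (is_derive_scale (dr w) dc).
    rewrite (_ : (fun t => _) = fun t => r w t ^+ 2 * g y z) => [H|].
      apply: (is_derive_eq H); rewrite r0 scaler0 addr0.
      by rewrite /GRing.scale/=; ring.
    by apply/funext => t; rewrite /GRing.scale/= expr2 mulrA.
  have H3 : is_derive (0 : R) 1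
      (fun t => g (T (x + t *: w) y) (T (x + t *: w) z)) (2 * al w * g y z).
    apply: near_eq_is_derive H2; near=> t; rewrite gT; last first.
      by near: t; exact: nearU.
    by congr (_ ^+ 2 * _); near: t; exact: rE.
  move: (@derive_val _ _ _ _ _ _ _ H1); rewrite (@derive_val _ _ _ _ _ _ _ H3).
  by rewrite scale0r addr0 !T_x => ->.
have nearf : \forall y \near x, differentiable f y.
  by apply: filterS (open_nbhs_nbhs (conj openU Ux)) => y; exact: df.
have BC y z : B y z = B z y.
  congr (L _); apply: second_derivative_symmetric => // w; exact: ddf.
have [a ga BE] := conformal_prolongation e0 BC gB.
have a0 : a = 0.
  apply/eqP; apply: contra_notT F1_non_euclidean => a_neq0.
  apply: (rotations_euclidean (g := g) mF1 a_neq0 dimV1) => w z.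
  exists (fun t => (r w t)^-1 *: T (x + t *: w) z); split.
  - by rewrite r0 scale0r addr0 T_x invr1 scale1r.
  - have rV : is_derive (0 : R) 1 (fun t => (r w t)^-1) (- al w).
      have r_neq0 : r w 0 != 0 by rewrite r0 oner_neq0.
      apply: (is_derive_eq (is_deriveV r_neq0 (dr w))).
      by rewrite r0 expr1n invr1 scaleN1r.
    apply: (is_derive_eq (is_derive_scale rV (dT w z))).
    rewrite r0 invr1 scale1r scale0r addr0 T_x BE !ga scaleNr.
    by rewrite -addrA addKr.
  - near=> t; have -> : r w t = lambda (x + t *: w) / lambda x.
      by near: t; exact: rE.
    have Ut : U (x + t *: w) by near: t; exact: nearU.
    have q0 : 0 < lambda (x + t *: w) / lambda x.
      by rewrite divr_gt0// lambda_gt0.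
    by rewrite F1Z ?invr_ge0 ?ltW// F1T// mulKf// gt_eqF.
have al0 w : al w = 0 by rewrite -ga a0 dot0l.
have : B v u = 0 by rewrite BE a0 !al0 !scale0r scaler0 subr0 addr0.
by move/(congr1 ('d f x)); rewrite /B LA linear0.
Unshelve. all: by end_near. Qed.

End ConformalMaps.

(** * Affine maps and the conclusion *)

Section AffineMaps.
Variables (R : realType) (V1 V2 : finNormedModType R).
Implicit Types (A : {linear V1 -> V2}) (b : V2).

Lemma diff_affine A b x : differentiable (fun y => A y + b) x /\
  ('d (fun y => A y + b) x : V1 -> V2) = A.
Proof.
have dA : is_diff x A A.
  by split; [exact/linear_differentiable/linear_fin_continuous|
    exact/diff_lin/linear_fin_continuous].
have [dAb ->] := is_diffD dA (is_diff_cst b x).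
by split=> //; rewrite addr0.
Qed.

Lemma class_C_cst k (U : set V1) (w : V2) : class_C k U (fun=> w).
Proof.
elim: k w => [|k IH] w /=; first by move=> x _; exact: cvg_cst.
split=> [x _|v]; first exact: differentiable_cst.
rewrite (_ : (fun x => _) = fun=> 0); first exact: IH.
by apply/funext => x; rewrite diff_cst.
Qed.

Lemma smooth_affine A b (U : set V1) : smooth U (fun x => A x + b).
Proof.
case=> [|k] /=.
  by move=> x _; apply/differentiable_continuous; case: (diff_affine A b x).
split=> [x _|v]; first by case: (diff_affine A b x).
rewrite (_ : (fun x => _) = fun=> A v); first exact: class_C_cst.
by apply/funext => x; rewrite (diff_affine A b x).2.
Qed.

End AffineMaps.

Lemma affine_diffeomorphism (R : realType) (V1 V2 : finNormedModType R)
    (A : {linear V1 -> V2}) (L : {linear V2 -> V1}) (b : V2) :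
  cancel A L -> cancel L A -> diffeomorphism setT setT (fun x => A x + b).
Proof.
move=> AL LA; split; last 1 first.
- exists (fun y => L y + - L b); last exact: smooth_affine.
  by move=> x _; rewrite linearD addrK AL.
- split=> [x _|x y _ _ /addIr /(can_inj AL)|y _] //.
  by exists (L (y - b)) => //; rewrite LA subrK.
- exact: smooth_affine.
Qed.

Theorem theorem4p1 (R : realType) (n : nat) (V1 V2 : finNormedModType R)
    (F1 : V1 -> R) (F2 : V2 -> R) (U1 : set V1) (U2 : set V2)
    (f : V1 -> V2) :
  (2 <= n)%N ->
  \dim {:V1} = n -> \dim {:V2} = n ->
  minkowski_norm F1 -> minkowski_norm F2 ->
  ~ euclidean F1 -> ~ euclidean F2 ->
  domain U1 -> domain U2 ->
  conformal_map F1 F2 U1 U2 f ->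
  isometric F1 F2 /\
  exists2 h : V1 -> V2, similarity F1 F2 h & {in U1, f =1 h}.
Proof.
move=> n2 dim1 dim2 mF1 mF2 nE1 _ [[x0 Ux0] cU oU] _.
move=> [[_ smoothf _] [lambda lambda0 flambda]].
have dimV1 : (2 <= \dim {:V1})%N by rewrite dim1.
have dimE : \dim {:V1} = \dim {:V2} by rewrite dim1.
have [df _] := smoothf 1%N.
have ddf x v : U1 x -> differentiable (fun y => 'd f y v) x.
  by move=> Ux; have [_ /(_ v)[+ _]] := smoothf 2%N; exact.
have [L [AL LA]] :=
  diff_conformal_inverse dimE mF1 mF2 lambda0 flambda Ux0.
have dd0 x u v : U1 x -> 'd (fun y => 'd f y u) x v = 0.
  exact: (second_diff_conformal dimV1 dimE mF1 mF2 nE1 oU df ddf lambda0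
    flambda).
pose A : {linear V1 -> V2} := 'd f x0.
have dfA x v : U1 x -> 'd f x v = A v.
  move=> Ux; apply: (@zero_diff_constant _ _ _ U1 (fun y => 'd f y v)) => //.
  - by move=> y; exact: ddf.
  - by move=> y w; exact: dd0.
pose b := f x0 - A x0.
have fA : {in U1, f =1 fun x => A x + b}.
  move=> x /set_mem Ux.
  suff : f x - A x = b by move=> <-; rewrite addrC subrK.
  have dfAB y : U1 y ->
      is_diff y (fun x => f x - A x) (('d f y : V1 -> V2) - (A : V1 -> V2)).
    move=> Uy; apply: is_diffB; first exact/differentiableP/df.
    by split; [exact/linear_differentiable/linear_fin_continuous|
      exact/diff_lin/linear_fin_continuous].
  apply: (@zero_diff_constant _ _ _ U1 (fun x => f x - A x)) => // y.
  - by move=> /dfAB[].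
  - move=> v Uy; have [_ ->] := dfAB _ Uy.
    by rewrite -[LHS]/('d f y v - A v) dfA// subrr.
set c := lambda x0; have c0 : 0 < c by exact: lambda0.
pose A' : {linear V1 -> V2} := c^-1 \*: A.
pose L' : {linear V2 -> V1} := c \*: L.
pose phi x := A' x + c^-1 *: b.
have phi_iso : finsler_isometry F1 F2 setT setT phi.
  split.
    apply: (@affine_diffeomorphism _ _ _ _ L') => v /=.
      by rewrite -linearZ/= scalerA mulfV ?gt_eqF// scale1r AL.
    by rewrite -linearZ/= scalerA mulVf ?gt_eqF// scale1r LA.
  move=> x _ v; rewrite (diff_affine A' _ x).2 /= mul1r.
  have [_ F2Z _ _] := mF2.
  by rewrite F2Z ?invr_ge0 ?ltW// flambda// mulKf// gt_eqF.
split; first by exists phi.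
exists (fun x => c *: phi x); first by exists c, phi.
by move=> x Ux; rewrite fA// /phi /= -scalerDr scalerA mulfV ?gt_eqF// scale1r.
Qed.
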